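(* Let $G=\mathrm{SL}(n,\mathbb R)$, $\Gamma=\mathrm{SL}(n,\mathbb Z)$, $X=G/\Gamma$, and let $A$ be the identity component of the full diagonal subgroup of $G$. Let $Ax$ be a divergent orbit in $X$ and let $\{g_k\}_{k\in\mathbb N}$ be a sequence in $G$ such that $[(g_k)_*\mu_{Ax}]$ converges in $\mathbb P\mathcal M(X)$ to an equivalence class $[\nu]$ of a locally finite periodic measure $\nu$. Then there exists a sequence $\lambda_k>0$ such that $\lambda_k(g_k)_*\mu_{Ax}\to\nu$ in $\mathcal M(X)$. In particular, for any $F_1,F_2\in C_c(X)$ with $\int F_1\,d\nu\neq0$, $$\frac{\int F_2\,d(g_k)_*\mu_{Ax}}{\int F_1\,d(g_k)_*\mu_{Ax}}\to\frac{\int F_2\,d\nu}{\int F_1\,d\nu}\quad(k\to\infty).$$ The same results hold if $A$ is replaced by any connected reductive subgroup $H$ of $G$ containing $A$: that is, if $Ax$ is divergent and $[(g_k)_*\mu_{Hx}]$ converges to $[\nu]$ with $\nu$ a locally finite periodic measure, then the two conclusions hold with $\mu_{Hx}$ in place of $\mu_{Ax}$.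
   Context: $A=\{\mathrm{diag}(e^{t_1},\dots,e^{t_n}):t_1+\dots+t_n=0\}$. An orbit $Ax$ is divergent if the map $a\mapsto ax$ from $A$ to $X$ is proper. For a closed subgroup $L<G$, an orbit $Lx$ is periodic if it supports an $L$-invariant locally finite Borel measure; such a measure is unique up to scaling and is denoted $\mu_{Lx}$, and is called a periodic measure. (For $H$ connected reductive containing $A$ and $Ax$ divergent, the orbit $Hx$ is closed and periodic.) For $g\in G$ and a measure $\mu$ on $X$, $g_*\mu(E)=\mu(g^{-1}E)$. $\mathcal M(X)$ is the space of locally finite (Borel) measures on $X$, with the smallest topology making $\mu\mapsto\int f\,d\mu$ continuous for every $f\in C_c(X)$. Two measures are equivalent if one is a positive multiple of the other; $[\mu]$ is the class of $\mu$, and $\mathbb P\mathcal M(X)$ is the set of classes of nonzero locally finite measures, with the quotient topology from $\mathcal M(X)\setminus\{0\}$. *)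

(* Defs.v *)
From HB Require Import structures.
From mathcomp Require Import all_boot all_order all_algebra.
From mathcomp Require Import all_classical all_reals all_analysis.

Set Implicit Arguments.
Unset Strict Implicit.
Unset Printing Implicit Defensive.

Import Order.TTheory GRing.Theory Num.Theory.
Import numFieldNormedType.Exports.

Local Open Scope classical_set_scope.
Local Open Scope ring_scope.
Local Open Scope quotient_scope.

Section LocallyFiniteMeasures.
Variables (R : realType) (T : ptopologicalType).

Definition borel := g_sigma_algebraType (@open T).

Definition locally_finite (m : set borel -> \bar R) :=
  forall x : T, exists2 U : set T, open_nbhs x U & (m U < +oo)%E.

Record lfmeasure := LFMeasure {
  lfm_measure :> {measure set borel -> \bar R};
  lfm_locally_finite : locally_finite lfm_measure }.

HB.instance Definition _ := gen_eqMixin lfmeasure.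
HB.instance Definition _ := gen_choiceMixin lfmeasure.

Definition Cc : set (T -> R) :=
  [set f | continuous f /\ compact (closure [set x | f x != 0])].

Definition lfm_int (f : T -> R) (m : lfmeasure) : R :=
  \int[m]_(x in [set: borel]) f x.

(* The coarsest topology making [lfm_int f] continuous for every f in Cc. *)
Definition measure_space : Type :=
  sup_topology (fun f : Cc =>
    Topological.class (initial_topology (lfm_int (set_val f)))).

HB.instance Definition _ := Topological.on measure_space.

Definition nonzero : set measure_space :=
  [set m | (m : lfmeasure) [set: borel] <> 0%E].

Definition nzmeasure : Type := set_type nonzero.

HB.instance Definition _ := Topological.on nzmeasure.

Definition nzm_val (m : nzmeasure) : lfmeasure := set_val m.

Coercion nzm_val : nzmeasure >-> lfmeasure.

Definition mknzm (m : lfmeasure) (m0 : m [set: borel] <> 0%E) : nzmeasure :=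
  SigSub (@mem_set _ nonzero _ m0).

(* Library measures are functions on all sets, constrained only on measurable
   ones, hence the comparison on measurable sets. *)
Definition proportional (m1 m2 : nzmeasure) : bool :=
  `[< exists2 c : R, 0 < c & forall E : set borel, measurable E ->
      m1 E = (c%:E * m2 E)%E >].

Lemma proportional_refl : reflexive proportional.
Proof.
by move=> m; apply/asboolP; exists 1 => // E mE; rewrite mul1e.
Qed.

Lemma proportional_sym : symmetric proportional.
Proof.
suff H m1 m2 : proportional m1 m2 -> proportional m2 m1.
  by move=> m1 m2; apply/idP/idP; exact: H.
move=> /asboolP[c c0 h]; apply/asboolP; exists c^-1; first by rewrite invr_gt0.
by move=> E mE; rewrite h// muleA -EFinM mulVf ?gt_eqF// mul1e.
Qed.

Lemma proportional_trans : transitive proportional.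
Proof.
move=> m2 m1 m3 /asboolP[c c0 h] /asboolP[e e0 k]; apply/asboolP.
exists (c * e); first exact: mulr_gt0.
by move=> E mE; rewrite h// k// muleA -EFinM.
Qed.

Canonical proportional_equiv :=
  EquivRel proportional proportional_refl proportional_sym proportional_trans.

Definition proj_measure_space : Type :=
  quotient_topology {eq_quot proportional_equiv}.

HB.instance Definition _ := Topological.on proj_measure_space.

Definition mclass (m : nzmeasure) : proj_measure_space :=
  \pi_{eq_quot proportional_equiv} m.

Lemma lfm_scale_subproof (c : {posnum R}) (m : lfmeasure) :
  locally_finite (mscale (NngNum (ltW (gt0 c))) m).
Proof.
move=> x; have [U xU mU] := lfm_locally_finite m x; exists U => //.
rewrite /mscale/=.
have : (0 <= m U)%E by exact: measure_ge0.
by case: (m U) mU => //= r _ _; rewrite -EFinM ltry.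
Qed.

Definition lfm_scale (c : {posnum R}) (m : lfmeasure) : measure_space :=
  LFMeasure (lfm_scale_subproof c m).

End LocallyFiniteMeasures.

Arguments Cc : clear implicits.

Section SpecialLinear.
Variables (R : realType) (n : nat).

Definition SL : Type := set_type [set M : 'M[R]_n | \det M = 1].

HB.instance Definition _ := Topological.on SL.

Definition SLmx (g : SL) : 'M[R]_n := set_val g.

Lemma det_SLmx (g : SL) : \det (SLmx g) = 1.
Proof. exact: (set_valP g). Qed.

Lemma SLmx_unit (g : SL) : SLmx g \in unitmx.
Proof. by rewrite unitmxE det_SLmx unitr1. Qed.

Lemma SLmx_inj : injective SLmx.
Proof. exact: val_inj. Qed.

Definition mkSL (M : 'M[R]_n) (M1 : \det M = 1) : SL := SigSub (mem_set M1).

Lemma SL1_subproof : \det (1%:M : 'M[R]_n) = 1.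
Proof. exact: det1. Qed.

Lemma SLM_subproof (g h : SL) : \det (SLmx g *m SLmx h) = 1.
Proof. by rewrite det_mulmx !det_SLmx mulr1. Qed.

Lemma SLV_subproof (g : SL) : \det (invmx (SLmx g)) = 1.
Proof. by rewrite det_inv det_SLmx invr1. Qed.

Definition SL1 := mkSL SL1_subproof.
Definition SLM g h := mkSL (SLM_subproof g h).
Definition SLV g := mkSL (SLV_subproof g).

Lemma SLMA : associative SLM.
Proof. by move=> g h k; apply: SLmx_inj; exact: mulmxA. Qed.
Lemma SLM1l : left_id SL1 SLM.
Proof. by move=> g; apply: SLmx_inj; exact: mul1mx. Qed.
Lemma SLM1r : right_id SL1 SLM.
Proof. by move=> g; apply: SLmx_inj; exact: mulmx1. Qed.
Lemma SLMVl : left_inverse SL1 SLV SLM.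
Proof. by move=> g; apply: SLmx_inj; exact: mulVmx (SLmx_unit g). Qed.
Lemma SLMVr : right_inverse SL1 SLV SLM.
Proof. by move=> g; apply: SLmx_inj; exact: mulmxV (SLmx_unit g). Qed.

HB.instance Definition _ := isGroup.Build SL SLMA SLM1l SLM1r SLMVl SLMVr.
HB.instance Definition _ := isPointed.Build SL SL1.

Local Open Scope group_scope.

Definition SLZ (g : SL) : bool := SLmx g \is a mxOver Num.int.

Lemma SLZ1 : SLZ 1.
Proof.
by apply/mxOverP => i j; rewrite /SLmx set_valE/= mxE; case: (_ == _).
Qed.

Lemma SLZM g h : SLZ g -> SLZ h -> SLZ (g * h).
Proof. exact: mxOverM. Qed.

Lemma SLZV g : SLZ g -> SLZ g^-1.
Proof.
move=> /mxOverP gZ; apply/mxOverP => i j.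
have -> : SLmx g^-1 = (\adj (SLmx g))%R.
  by rewrite /SLmx set_valE/= /invmx SLmx_unit det_SLmx invr1 scale1r.
rewrite mxE rpredM ?rpredX ?rpredN ?rpred1//.
apply: rpred_sum => s _; rewrite rpredM ?rpredX ?rpredN ?rpred1//.
by apply: rpred_prod => k _; rewrite !mxE; exact: gZ.
Qed.

Definition eqmodZ (g h : SL) : bool := SLZ (g^-1 * h).

Lemma eqmodZ_refl : reflexive eqmodZ.
Proof. by move=> g; rewrite /eqmodZ mulVg SLZ1. Qed.

Lemma eqmodZ_sym : symmetric eqmodZ.
Proof.
suff H g h : eqmodZ g h -> eqmodZ h g by move=> g h; apply/idP/idP; exact: H.
by move/SLZV; rewrite invgM invgK.
Qed.

Lemma eqmodZ_trans : transitive eqmodZ.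
Proof.
move=> h g k gh hk; have := SLZM gh hk.
by rewrite -mulgA (mulgA h) mulgV mul1g.
Qed.

Canonical eqmodZ_equiv :=
  EquivRel eqmodZ eqmodZ_refl eqmodZ_sym eqmodZ_trans.

(* G / Gamma, the space of left cosets g Gamma, with the quotient topology. *)
Definition SLquo : Type := quotient_topology {eq_quot eqmodZ_equiv}.

HB.instance Definition _ := PointedTopological.on SLquo.

Definition cosetZ (g : SL) : SLquo := \pi_{eq_quot eqmodZ_equiv} g.

Definition act (g : SL) (x : SLquo) : SLquo :=
  cosetZ (g * repr (x : {eq_quot eqmodZ_equiv})).

Lemma eq_cosetZ g h : cosetZ g = cosetZ h <-> eqmodZ g h.
Proof. by split=> [/eqmodP//|gh]; apply/eqmodP. Qed.

Lemma act_cosetZ g h : act g (cosetZ h) = cosetZ (g * h).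
Proof.
apply/eq_cosetZ; rewrite /eqmodZ invgM -mulgA mulKg.
by apply/eq_cosetZ; rewrite /cosetZ reprK.
Qed.

Lemma cosetZP (x : SLquo) : exists g, x = cosetZ g.
Proof. by exists (repr (x : {eq_quot eqmodZ_equiv})); rewrite /cosetZ reprK. Qed.

Lemma act1 x : act 1 x = x.
Proof. by have [g ->] := cosetZP x; rewrite act_cosetZ mul1g. Qed.

Lemma actM g h x : act (g * h) x = act g (act h x).
Proof. by have [k ->] := cosetZP x; rewrite !act_cosetZ mulgA. Qed.

Lemma SL_mull_continuous (g : SL) : continuous (fun h : SL => g * h).
Proof.
apply: continuous_comp_initial => h.
have cg (N : 'M[R]_n) : mulmx (SLmx g) M @[M --> N] --> SLmx g *m N.
  move=> U [P hP PU]; rewrite nbhs_filterE/=.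
  suff : \forall M \near N, forall i j, P i j ((SLmx g *m M) i j).
    by apply: filterS => M; exact: PU.
  apply: (@filter_forall _ _
    (fun i M => forall j, P i j ((SLmx g *m M) i j)) _ (nbhs_filter N)) => i.
  apply: (@filter_forall _ _ (fun j M => P i j ((SLmx g *m M) i j)) _
    (nbhs_filter N)) => j.
  suff : (SLmx g *m M) i j @[M --> N] --> (SLmx g *m N) i j by apply.
  rewrite mxE; under eq_fun do rewrite mxE.
  apply: cvg_big; [exact: add_continuous|exact: nbhs_filter|].
  by move=> k _; apply: (cvgMr (FF := nbhs_filter N)); exact: coord_continuous.
apply: (@continuous_comp SL 'M[R]_n 'M[R]_n set_val (mulmx (SLmx g))).
  exact: initial_continuous.
exact: cg.
Qed.

Lemma act_continuous (g : SL) : continuous (act g).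
Proof.
apply/quotient_continuous => h.
rewrite (_ : _ \o _ = cosetZ \o (fun k => g * k)); last first.
  by apply/funext => k /=; exact: act_cosetZ.
apply: continuous_comp; first exact: SL_mull_continuous.
exact: pi_continuous.
Qed.

Lemma measurable_act (g : SL) :
  measurable_fun [set: borel SLquo] (act g : borel SLquo -> borel SLquo).
Proof.
apply: (@measurability _ _ (borel SLquo) (borel SLquo) setT (act g)
  (@open SLquo)) => //.
move=> _ [U oU <-]; rewrite setTI; apply: sub_sigma_algebra.
by move/continuousP : (@act_continuous g); exact.
Qed.

Section Pushforward.
Variables (g : SL) (m : lfmeasure R SLquo).

Definition act_pushforward : set (borel SLquo) -> \bar R :=
  pushforward m (act g : borel SLquo -> borel SLquo).

Let mg := measurable_act g.

Lemma act_pushforward0 : act_pushforward set0 = 0%E.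
Proof. exact: measure0. Qed.

Lemma act_pushforward_ge0 E : (0 <= act_pushforward E)%E.
Proof. exact: measure_ge0. Qed.

Lemma act_pushforward_sigma_additive : semi_sigma_additive act_pushforward.
Proof. exact: measure_semi_sigma_additive. Qed.

HB.instance Definition _ := isMeasure.Build _ _ _ act_pushforward
  act_pushforward0 act_pushforward_ge0 act_pushforward_sigma_additive.

Lemma act_pushforward_locally_finite : locally_finite act_pushforward.
Proof.
move=> x; have [U [oU Ux] mU] := lfm_locally_finite m (act g^-1 x).
exists (act g^-1 @^-1` U).
  by split=> //; move/continuousP : (@act_continuous g^-1); exact.
rewrite /act_pushforward /pushforward (_ : _ @^-1` _ = U)//.
by apply/seteqP; split => y /=; rewrite -actM mulVg act1.
Qed.

Definition lfm_push : lfmeasure R SLquo :=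
  LFMeasure act_pushforward_locally_finite.

End Pushforward.

Lemma nzm_push_subproof g (m : nzmeasure R SLquo) :
  lfm_push g m [set: borel SLquo] <> 0%E.
Proof.
rewrite /=.
by rewrite /act_pushforward /pushforward preimage_setT; exact: (set_valP m).
Qed.

Definition nzm_push g (m : nzmeasure R SLquo) :
    nzmeasure R SLquo := mknzm (@nzm_push_subproof g m).

Definition act_orbit (L : set SL) (x : SLquo) : set SLquo :=
  [set act g x | g in L].

Definition diagA : set SL :=
  [set g | exists2 t : 'rV[R]_n,
    (\sum_i t ord0 i = 0)%R & SLmx g = diag_mx (map_mx expR t)].

(* Properness of a |-> a x on A; this map is continuous, so only preimages of
   compact sets matter. *)
Definition divergent_orbit (x : SLquo) : Prop :=
  forall K : set SLquo, compact K -> compact [set a | diagA a /\ K (act a x)].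

Definition closed_subgroup (L : set SL) : Prop :=
  [/\ closed L, L 1, (forall g h, L g -> L h -> L (g * h)) &
      forall g, L g -> L g^-1].

(* m is an L-invariant measure carried by the orbit L x; being nonzero and
   locally finite is part of the type of m. *)
Definition orbit_measure (L : set SL) (x : SLquo)
    (m : nzmeasure R SLquo) : Prop :=
  (forall g, L g -> forall E : set (borel SLquo), measurable E ->
    nzm_push g m E = m E) /\
  m.-negligible (~` act_orbit L x).

Definition periodic_measure (m : nzmeasure R SLquo) : Prop :=
  exists2 L, closed_subgroup L & exists x, orbit_measure L x m.

Local Open Scope ring_scope.

Definition expmx (Y : 'M[R]_n) : 'M[R]_n :=
  limn (series (fun k => (k`!%:R)^-1 *: Y ^+ k)).

Definition lie_algebra (H : set SL) : set 'M[R]_n :=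
  [set Y | forall t : R, exists2 h, H h & SLmx h = expmx (t *: Y)].

Definition lie_ideal (h I : set 'M[R]_n) : Prop :=
  [/\ I `<=` h, I 0, (forall a Y Z, I Y -> I Z -> I (a *: Y + Z)) &
      forall Y Z, h Y -> I Z -> I (Y *m Z - Z *m Y)].

(* A Lie algebra is reductive if its adjoint representation is completely
   reducible, i.e. if every ideal has a complementary ideal. *)
Definition reductive_lie (h : set 'M[R]_n) : Prop :=
  forall I, lie_ideal h I -> exists J, [/\ lie_ideal h J,
    I `&` J = [set 0] & h = [set Y + Z | Y in I & Z in J]].

Definition connected_reductive (H : set SL) : Prop :=
  [/\ closed_subgroup H, connected H & reductive_lie (lie_algebra H)].

End SpecialLinear.

Arguments diagA : clear implicits.

(* Main.v *)
Require Import Defs.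
From mathcomp Require Import all_boot all_order all_algebra.
From mathcomp Require Import all_classical all_reals all_analysis.
From mathcomp Require Import measurable_realfun ring lra.
Import Order.TTheory GRing.Theory Num.Theory.
Import numFieldNormedType.Exports.

Set Implicit Arguments.
Unset Strict Implicit.
Unset Printing Implicit Defensive.

Local Open Scope classical_set_scope.
Local Open Scope ring_scope.

(** The space [X] is Hausdorff, locally compact and sigma-compact, so a nonzero
    locally finite measure [nu] has [nu(f0) > 0] for some [f0] in [C_c(X)].  For
    every [f] in [C_c(X)] and [e > 0], the conditions [m(f0) > 0] and
    [|m(f) - c m(f0)| < e m(f0)] with [c = nu(f) / nu(f0)] define an open set of
    measures that is stable under scaling, hence a neighbourhood of the class of
    [nu] in the projective space.  So convergence of the classes of [m_k] forces
    [m_k(f) / m_k(f0) -> nu(f) / nu(f0)], and [lambda_k = nu(f0) / m_k(f0)]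
    works. *)

(** * Integrals of compactly supported functions and convergence of classes *)

Section LocallyFiniteMeasureIntegrals.
Variables (R : realType) (T : ptopologicalType).
Implicit Types (m : lfmeasure R T) (f : T -> R).

Lemma open_borel_measurable (U : set T) :
  open U -> measurable (U : set (borel T)).
Proof. exact: sub_sigma_algebra. Qed.

Lemma closed_borel_measurable (C : set T) :
  closed C -> measurable (C : set (borel T)).
Proof.
move=> cC; rewrite -[C]setCK; apply: measurableC.
by apply: open_borel_measurable; rewrite openC.
Qed.

Lemma continuous_borel_measurable f :
  continuous f -> measurable_fun [set: borel T] (f : borel T -> R).
Proof.
move=> /continuousP cf.
apply: (measurability _ (RGenOpens.measurableE R)).
move=> _ [_ [a [b ->]] <-]; rewrite setTI.
by apply: open_borel_measurable; apply: cf; exact: interval_open.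
Qed.

(** Finitely many of the open sets of finite measure given by local finiteness cover [K]. *)
Lemma lfm_compact_lty m (K : set T) : compact K -> closed K -> (m K < +oo)%E.
Proof.
move=> + clK; rewrite compact_cover => cK.
pose U x := sval (cid2 (lfm_locally_finite m x)).
have oU x : open (U x) by rewrite /U; case: cid2 => V [].
have Ux x : U x x by rewrite /U; case: cid2 => V [].
have mU x : (m (U x) < +oo)%E by rewrite /U; case: cid2.
have [D _ KD] : finite_subset_cover setT U K.
  by apply: cK => // x _; exists x.
apply: le_lt_trans.
  apply: (content_sub_fsum m (finite_fset D) _ _ KD).
    by move=> i _; exact: open_borel_measurable.
  exact: closed_borel_measurable.
rewrite fsbig_finite//=; by elim/big_ind: _ => //; exact: lte_add_pinfty.
Qed.

(** [|f|] is dominated by [M] times the indicator of its compact support, which has finite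
    measure. *)
Lemma lfm_integrable m f : Cc R T f ->
  (m : {measure set borel T -> \bar R}).-integrable [set: borel T] (EFin \o f).
Proof.
move=> [cf cK]; set K := closure _ in cK.
have clK : closed K by exact: closed_closure.
have mK : measurable (K : set (borel T)) by exact: closed_borel_measurable.
have mf := continuous_borel_measurable cf.
have [M M0 fM] : exists2 M, 0 < M & forall x, K x -> `|f x| <= M.
  have /compact_bounded/pinfty_ex_gt0[M M0 hM] : compact (f @` K : set R^o).
    by apply: continuous_compact => //; exact: continuous_subspaceT.
  by exists M => // x Kx; apply: hM; exists x.
apply/integrableP; split; first exact/measurable_EFinP.
apply: (@le_lt_trans _ _
  (\int[m]_(x in [set: borel T]) (M%:E * (\1_K x)%:E))%E).
  apply: ge0_le_integral => //=.
  - by do 2 apply: measurableT_comp => //.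
  - by apply: measurable_funeM; apply/measurable_EFinP; exact: measurable_indic.
  move=> x _; rewrite -EFinM lee_fin indicE.
  have [/set_mem/fM|/negP xK] := boolP (x \in K); first by rewrite mulr1.
  rewrite mulr0 normr_le0; apply: contra_notT xK => fx.
  by apply/mem_set/subset_closure.
rewrite ge0_integralZl_EFin//; last 2 first.
  by apply/measurable_EFinP; exact: measurable_indic.
  exact: ltW.
rewrite integral_indic// setIT.
have := lfm_compact_lty m cK clK.
have : (0 <= m K)%E by exact: measure_ge0.
by case: (m K) => //= r _ _; rewrite -EFinM ltry.
Qed.

(** The integral sees only measurable sets, so [m1] can be replaced by the scaled measure; positive
    and negative parts are then scaled separately. *)
Lemma lfm_int_proportional (c : R) m1 m2 f : Cc R T f -> 0 < c ->
  (forall E : set (borel T), measurable E -> m1 E = (c%:E * m2 E)%E) ->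
  lfm_int f m1 = c * lfm_int f m2.
Proof.
move=> Cf c0 m12; rewrite /lfm_int /Rintegral.
have intf := lfm_integrable m2 Cf.
have mf := measurable_int _ intf.
rewrite (eq_measure_integral (mscale (NngNum (ltW c0)) m2)); last first.
  by move=> A mA _; rewrite m12.
rewrite integralE !ge0_integral_mscale//; last 2 first.
  exact: measurable_funeneg.
  exact: measurable_funepos.
rewrite -muleBr//; last first.
  apply: fin_num_adde_defr; exact: integrable_pos_fin_num.
by rewrite -integralE fineM//; exact: integrable_fin_num.
Qed.

Lemma lfm_int_scale (c : {posnum R}) m f : Cc R T f ->
  lfm_int f (lfm_scale c m) = c%:num * lfm_int f m.
Proof. by move=> Cf; exact: lfm_int_proportional. Qed.

(** Markov's inequality: [e] times the measure of the superlevel set is at most the integral. *)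
Lemma lfm_int_gt0 m f (e : R) : Cc R T f -> (forall x, 0 <= f x) -> 0 < e ->
  (0 < m [set x | (e <= f x)%R])%E -> 0 < lfm_int f m.
Proof.
move=> Cf f0 e0 mf0; rewrite /lfm_int /Rintegral.
have intf := lfm_integrable m Cf.
have := @le_integral_comp_abse _ _ _ m setT measurableT (EFin \o f) e id
   (@measurable_id _ _ _) (fun r => id) (fun x y _ _ => id)
   (measurable_int _ intf) e0.
rewrite setTI /=.
have -> : [set x | (e%:E <= `|f x|%:E)%E] = [set x | e <= f x].
  by apply/seteqP; split=> x /=; rewrite lee_fin ger0_norm.
under eq_integral do rewrite ger0_norm//.
move=> h; rewrite -lte_fin fineK; last exact: integrable_fin_num.
by apply: lt_le_trans h; rewrite mule_gt0.
Qed.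

Lemma lfm_int_continuous f : Cc R T f ->
  continuous (lfm_int f : measure_space R T -> R).
Proof.
move=> Cf m.
have /cvg_sup/(_ (SigSub (mem_set Cf))) : nbhs m --> m by exact: cvg_id.
move=> h U Uf; apply: h.
have := @initial_continuous (lfmeasure R T) R (lfm_int f) m U Uf.
by [].
Qed.

Lemma cvg_measure_space (I : Type) (F : set_system I)
    (u : I -> measure_space R T) (m : lfmeasure R T) : Filter F ->
  (forall f, Cc R T f -> lfm_int f (u i) @[i --> F] --> lfm_int f m) ->
  u i @[i --> F] --> (m : measure_space R T).
Proof.
move=> FF h; apply/cvg_sup => -[f /= Cf] A /= [_ [[B oB <-] Bm sBA]].
apply: (@filterS _ F _ _ _ (fun i => sBA (u i))).
by apply: (h f); [exact: set_mem|exact: open_nbhs_nbhs].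
Qed.

(** A saturated open set descends to an open set of the quotient. Quantifying over all
    representatives of [p] lets the conclusion be read off at any chosen one. *)
Lemma nbhs_mclass (W : set (measure_space R T)) (nu : nzmeasure R T) :
  open W -> (forall m1 m2 : nzmeasure R T,
    proportional m1 m2 -> W (nzm_val m1) -> W (nzm_val m2)) ->
  W (nzm_val nu) -> nbhs (mclass nu)
    [set p | forall m : nzmeasure R T, mclass m = p -> W (nzm_val m)].
Proof.
move=> oW sW Wnu.
have mW (m1 m2 : nzmeasure R T) :
    mclass m1 = mclass m2 -> W (nzm_val m1) -> W (nzm_val m2).
  by move=> /eqmodP; exact: sW.
apply: open_nbhs_nbhs; split; last first.
  by move=> m /= mn; apply: mW Wnu.
rewrite /open/= /quotient_open.
rewrite (_ : _ @^-1` _ = @nzm_val R T @^-1` W); first by exists W.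
apply/seteqP; split => m /=; first exact.
by move=> Wm m' mm'; apply: mW Wm.
Qed.

Lemma cvg_mclass_scale (f0 : T -> R) (m : nat -> nzmeasure R T)
    (nu : nzmeasure R T) : Cc R T f0 -> 0 < lfm_int f0 nu ->
  mclass (m k) @[k --> \oo] --> mclass nu ->
  exists lambda : nat -> {posnum R},
    lfm_scale (lambda k) (m k) @[k --> \oo] -->
      (nzm_val nu : measure_space R T).
Proof.
move=> Cf0 nu0 mnu.
(* The estimate on the ratio is kept free of division, hence homogeneous in the measure. *)
have evW f (e : R) : Cc R T f -> 0 < e -> \forall k \near \oo,
    0 < lfm_int f0 (m k) /\
    `|lfm_int f (m k) - lfm_int f nu / lfm_int f0 nu * lfm_int f0 (m k)|
      < e * lfm_int f0 (m k).
  move=> Cf e0; set c := lfm_int f nu / lfm_int f0 nu.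
  (* Scaling the measure by [a > 0] multiplies [h] by [a], so the condition [0 < h] passes to
     classes; being continuous, [h] makes it open. *)
  pose h (x : measure_space R T) :=
    e * lfm_int f0 x - `|lfm_int f x - c * lfm_int f0 x|.
  have ch : continuous h.
    suff cont (S : topologicalType) (u v : S -> R) : continuous u ->
        continuous v -> continuous (fun x => e * u x - `|v x - c * u x|).
      by apply: cont; exact: lfm_int_continuous.
    move=> cu cv x; apply: cvgB; first by apply: cvgMl_tmp; exact: cu.
    apply: cvg_norm; apply: cvgB; first exact: cv.
    by apply: cvgMl_tmp; exact: cu.
  pose W : set (measure_space R T) :=
    (lfm_int f0 @^-1` [set r | 0 < r]) `&` (h @^-1` [set r | 0 < r]).
  have oW : open W.
    apply: openI.
      by move/continuousP: (lfm_int_continuous Cf0); apply; exact: open_gt.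
    by move/continuousP: ch; apply; exact: open_gt.
  have : nbhs (mclass nu)
      [set p | forall m : nzmeasure R T, mclass m = p -> W (nzm_val m)].
    apply: nbhs_mclass => //.
      move=> m1 m2; rewrite proportional_sym => /asboolP[a a0 m21] [/= W1 W2].
      have E g : Cc R T g -> lfm_int g m2 = a * lfm_int g m1.
        by move=> Cg; exact: lfm_int_proportional.
      split => /=; first by rewrite E// mulr_gt0.
      rewrite /h !E// mulrCA (mulrCA c) -mulrBr normrM gtr0_norm// -mulrBr.
      exact: mulr_gt0.
    (* At [nu] the absolute value vanishes by the choice of [c], leaving [e * lfm_int f0 nu]. *)
    split => //=; rewrite /h /c divfK ?gt_eqF// subrr normr0 subr0.
    exact: mulr_gt0.
  move=> /mnu ev; apply: (@filterS _ \oo _ _ _ _ ev) => k.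
  move=> /(_ _ erefl)[/= m0 hm].
  by split => //; rewrite -subr_gt0.
pose r k := lfm_int f0 nu / lfm_int f0 (m k).
(* The default 1 is taken at only finitely many [k], since [r k] is eventually positive. *)
exists (fun k => if pselect (0 < r k) is left r0 then PosNum r0 else 1%:pos).
apply: cvg_measure_space => f Cf; apply/cvgrPdist_lt => e e0.
near=> k.
(* The tolerance is divided by [lfm_int f0 nu] so that multiplying by [r k] gives exactly [e]. *)
have [m0 mk] : 0 < lfm_int f0 (m k) /\
    `|lfm_int f (m k) - lfm_int f nu / lfm_int f0 nu * lfm_int f0 (m k)|
      < e / lfm_int f0 nu * lfm_int f0 (m k).
  by near: k; apply: evW => //; rewrite divr_gt0.
have rk : 0 < r k by rewrite divr_gt0.
rewrite lfm_int_scale//; case: pselect => //= rk'.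
have -> : lfm_int f nu - r k * lfm_int f (m k) = - (r k *
    (lfm_int f (m k) - lfm_int f nu / lfm_int f0 nu * lfm_int f0 (m k))).
  rewrite mulrBr opprB; congr (_ - _); rewrite /r.
  by field; rewrite !gt_eqF.
rewrite normrN normrM gtr0_norm// -ltr_pdivlMl//; apply: (lt_le_trans mk).
by rewrite le_eqVlt; apply/orP; left; apply/eqP; rewrite /r; field;
  rewrite !gt_eqF.
Unshelve. all: by end_near. Qed.

(** The factors [lambda k] cancel in the quotient, and each rescaled integral converges because
    integration against a function of [Cc] is continuous. *)
Lemma cvg_lfm_int_ratio (m : nat -> lfmeasure R T) (nu : lfmeasure R T)
    (lambda : nat -> {posnum R}) (F1 F2 : T -> R) :
  lfm_scale (lambda k) (m k) @[k --> \oo] --> (nu : measure_space R T) ->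
  Cc R T F1 -> Cc R T F2 -> lfm_int F1 nu <> 0 ->
  lfm_int F2 (m k) / lfm_int F1 (m k) @[k --> \oo] -->
    lfm_int F2 nu / lfm_int F1 nu.
Proof.
move=> lm CF1 CF2 /eqP F1nu.
have cF f : Cc R T f ->
    (lambda k)%:num * lfm_int f (m k) @[k --> \oo] --> lfm_int f nu.
  move=> Cf; have := cvg_comp _ _ lm (@lfm_int_continuous _ Cf nu).
  by apply: cvg_trans; apply: near_eq_cvg; apply: nearW => k /=;
    rewrite lfm_int_scale.
(* This holds for every [k], even where the denominator vanishes, as the inverse of 0 is 0. *)
have -> : (fun k => lfm_int F2 (m k) / lfm_int F1 (m k)) =
    (fun k => ((lambda k)%:num * lfm_int F2 (m k)) *
              ((lambda k)%:num * lfm_int F1 (m k))^-1).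
  by apply/funext => k; rewrite invfM mulrACA divff ?mul1r.
by apply: cvgM; [exact: cF|apply: cvgV => //; exact: cF].
Qed.

End LocallyFiniteMeasureIntegrals.

(** * Bump functions on locally compact Hausdorff spaces *)

Section LocallyCompact.
Variables (R : realType) (T : ptopologicalType).
Hypotheses (hT : hausdorff_space T) (lT : locally_compact [set: T]).

(** Complete regularity gives [g] with value 0 at [x] and 1 outside the interior of a compact
    neighbourhood [U]; then [1 - g] is supported in [U]. *)
Lemma Cc_bump (x : T) : exists f : T -> R,
  [/\ Cc R T f, forall y, 0 <= f y & f x = 1].
Proof.
have [U] := @lT x I; rewrite withinET => xU [cU clU].
have oV : open U° by exact: open_interior.
have [] := @locally_compact_completely_regular T R lT hT x (~` U°).
- exact: open_closedC.
- by move=> /(_ xU).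
move=> E sep.
have /(uniform_separatorP (R := R))[g [cg g01 g0 g1]] :
  uniform_separator [set x] (~` U°) by exists E.
have gx y : 0 <= g y <= 1.
  by have := g01 (g y) (ex_intro2 _ _ y I erefl); rewrite /= in_itv.
exists (fun y => 1 - g y); split.
- split.
    by move=> y; apply: cvgB; [exact: cvg_cst|exact: cg].
  apply: (subclosed_compact _ cU); first exact: closed_closure.
  rewrite [X in _ `<=` X](closure_id _).1//; apply: closureS => y /= gy.
  apply: contrapT => nUy; move/negP: gy; apply.
  rewrite (_ : g y = 1) ?subrr//; apply: g1; exists y => //.
  by move=> /interior_subset.
- by move=> y; rewrite subr_ge0; case/andP: (gx y).
- by rewrite (_ : g x = 0) ?subr0//; apply: g0; exists x.
Qed.

(** By sigma-compactness some [K j] has nonzero measure. Finitely many sets where a bump function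
    exceeds 1/2 cover it, so one of these has positive measure. *)
Lemma Cc_int_gt0 (K : nat -> set T) (nu : nzmeasure R T) :
  (forall j, compact (K j)) -> \bigcup_j K j = setT ->
  exists2 f, Cc R T f & 0 < lfm_int f nu.
Proof.
move=> cK KT.
have mK j : measurable (K j : set (borel T)).
  by apply: closed_borel_measurable; exact: compact_closed.
have [j nuK] : exists j, nu (K j) <> 0%E.
  apply: contrapT => /forallNP nK.
  have /(_ nu) nu0 := @set_valP _ (@nonzero R T).
  apply: nu0; apply/negligibleP; first exact: measurableT.
  rewrite -KT; apply: negligible_bigcup => j; apply/negligibleP => //.
  exact: contrapT (nK j).
pose f x := sval (cid (Cc_bump x)).
have Cf x : Cc R T (f x) by rewrite /f; case: cid => ? [].
have f_ge0 x y : 0 <= f x y by rewrite /f; case: cid => ? [].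
have fxx x : f x x = 1 by rewrite /f; case: cid => ? [].
pose V x := f x @^-1` [set r | 2^-1 < r].
have oV x : open (V x).
  by have [/continuousP cf _] := Cf x; apply: cf; exact: open_gt.
have mV x : measurable (V x : set (borel T)) by exact: open_borel_measurable.
have [D _ KD] : finite_subset_cover setT V (K j).
  have := cK j; rewrite compact_cover; apply=> // x _; exists x => //.
  by rewrite /V /= fxx; lra.
have [x nuV] : exists x, (0 < nu (V x))%E.
  apply: contrapT => /forallNP nV; apply: nuK.
  apply/eqP; rewrite eq_le measure_ge0 andbT.
  apply: le_trans
    (content_sub_fsum nu (finite_fset D) (fun i _ => mV i) (mK j) KD) _.
  rewrite fsbig1// => i _; apply/eqP; rewrite eq_le measure_ge0 andbT leNgt.
  exact/negP/nV.
exists (f x) => //; apply: (@lfm_int_gt0 _ _ _ _ 2^-1) => //.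
apply: (lt_le_trans nuV); apply: le_measure; rewrite ?inE//.
  apply: closed_borel_measurable.
  rewrite (_ : [set _ | _] = f x @^-1` [set r | 2^-1 <= r])//.
  by apply: preimage_closed => [y _|]; [exact: (Cf x).1|exact: closed_ge].
by move=> y; exact: ltW.
Qed.

End LocallyCompact.

(** * Entrywise convergence, compactness of boxes, and non-integers *)

Section MatrixTopology.
Variable R : realType.

(** Neighbourhoods of a matrix are generated by finite products of neighbourhoods of its entries. *)
Lemma cvg_mx (I : Type) (F : set_system I) (p q : nat) (u : I -> 'M[R]_(p, q))
    (M : 'M[R]_(p, q)) : Filter F ->
  (forall i j, u x i j @[x --> F] --> M i j) -> u x @[x --> F] --> M.
Proof.
move=> FF h U [P hP PU].
suff : \forall x \near F, forall i j, P i j (u x i j).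
  by apply: filterS => x; exact: PU.
apply: (@filter_forall _ _ (fun i x => forall j, P i j (u x i j)) F FF) => i.
apply: (@filter_forall _ _ (fun j x => P i j (u x i j)) F FF) => j.
exact: h.
Qed.

Lemma cvg_mx_coord (I : Type) (F : set_system I) (p q : nat)
    (u : I -> 'M[R]_(p, q)) (M : 'M[R]_(p, q)) i j :
  u x @[x --> F] --> M -> u x i j @[x --> F] --> M i j.
Proof. by move=> h; exact: cvg_comp h (@coord_continuous R p q i j M). Qed.

Lemma cvg_mulmx (I : Type) (F : set_system I) (p q r : nat)
    (u : I -> 'M[R]_(p, q)) (v : I -> 'M[R]_(q, r))
    (M : 'M[R]_(p, q)) (N : 'M[R]_(q, r)) : Filter F ->
  u x @[x --> F] --> M -> v x @[x --> F] --> N ->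
  u x *m v x @[x --> F] --> M *m N.
Proof.
move=> FF uM vN; apply: cvg_mx => i j; rewrite mxE; under eq_fun do rewrite mxE.
apply: cvg_big; first exact: add_continuous.
by move=> k _; apply: cvgM; exact: cvg_mx_coord.
Qed.

Lemma cvg_det (I : Type) (F : set_system I) (n : nat) (u : I -> 'M[R]_n)
    (M : 'M[R]_n) :
  Filter F -> u x @[x --> F] --> M -> \det (u x) @[x --> F] --> \det M.
Proof.
move=> FF uM; apply: cvg_big; first exact: add_continuous.
move=> s _; apply: cvgM; first exact: cvg_cst.
apply: cvg_big; first exact: mul_continuous.
by move=> k _; exact: cvg_mx_coord.
Qed.

Lemma cvg_adj (I : Type) (F : set_system I) (n : nat) (u : I -> 'M[R]_n)
    (M : 'M[R]_n) :
  Filter F -> u x @[x --> F] --> M -> \adj (u x) @[x --> F] --> \adj M.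
Proof.
move=> FF uM; apply: cvg_mx => i j; rewrite mxE; under eq_fun do rewrite mxE.
apply: cvgM; first exact: cvg_cst.
apply: cvg_det; apply: cvg_mx => k l; rewrite !mxE.
under eq_fun do rewrite !mxE.
exact: cvg_mx_coord.
Qed.

(** The box is the continuous image, by reshaping, of a product of segments in the space of row
    vectors. *)
Lemma compact_mx_box (p q : nat) (r : R) :
  compact [set M : 'M[R]_(p, q) | forall i j, `|M i j| <= r].
Proof.
rewrite (_ : [set _ | _] =
    vec_mx @` [set v : 'rV[R]_(p * q) | forall i, v ord0 i \in `[- r, r]]).
  apply: continuous_compact.
    apply: continuous_subspaceT => v.
    apply: (cvg_mx (nbhs_filter v)) => i j; rewrite mxE.
    under eq_fun do rewrite mxE.
    exact: coord_continuous.
  apply: (@rV_compact R _ (fun=> [set` `[- r, r]])) => i.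
  exact: segment_compact.
apply/seteqP; split => [M MR|_ [v vr <-] i j].
  exists (mxvec M); last exact: mxvecK.
  move=> k; case/mxvec_indexP: k => i j; rewrite mxvecE in_itv/= -ler_norml.
  exact: MR.
by rewrite mxE ler_norml; have := vr (mxvec_index i j); rewrite in_itv.
Qed.

(** The open interval between consecutive integers around [r] contains no integer. This openness is
    what separates distinct cosets below. *)
Lemma open_not_int : open [set r : R | r \isn't a Num.int].
Proof.
rewrite openE => r /= rZ; set k := Num.floor r.
have kr : k%:~R < r.
  by rewrite lt_neqAle Num.Theory.floor_le andbT -intrEfloor.
have rk : r < (k + 1)%:~R by exact: Num.Theory.floorD1_gt.
have : nbhs r `]k%:~R, (k + 1)%:~R[%classic.
  apply: open_nbhs_nbhs; split; first exact: interval_open.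
  by rewrite /= in_itv/= kr.
apply: filterS => s /=; rewrite in_itv/= => /andP[ks sk].
apply/negP => /intrP[z sz]; move: ks sk; rewrite sz !ltr_int ltzD1 => kz zk.
by move: (lt_le_trans kz zk); rewrite ltxx.
Qed.

End MatrixTopology.

(** * The quotient of SL(n,R) by SL(n,Z): Hausdorff, locally compact, sigma-compact *)

Section SLquoTopology.
Variables (R : realType) (n : nat).
Local Open Scope group_scope.

Lemma SLmx_continuous : continuous (@SLmx R n).
Proof. exact: initial_continuous. Qed.

(** [SL] has the topology induced by its inclusion into matrices. *)
Lemma cvg_SL (I : Type) (F : set_system I) (u : I -> SL R n) (g : SL R n) :
  Filter F -> SLmx (u x) @[x --> F] --> SLmx g -> u x @[x --> F] --> g.
Proof.
move=> FF h A /= [_ [[B oB <-] Bm sBA]].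
apply: (@filterS _ F _ _ _ (fun i => sBA (u i))).
by apply: h; exact: open_nbhs_nbhs.
Qed.

Lemma SL_mulr_continuous (g : SL R n) : continuous (fun h : SL R n => h * g).
Proof.
move=> h; apply: (cvg_SL (nbhs_filter h)).
apply: (@cvg_mulmx _ _ _ _ _ _ (@SLmx R n) (fun=> SLmx g) _ _ (nbhs_filter h)).
  exact: SLmx_continuous.
exact: (cvg_cst (SLmx g) (FF := nbhs_filter h)).
Qed.

(** The adjugate is polynomial in the entries, which makes inversion continuous. *)
Lemma SLmx_inv (g : SL R n) : SLmx g^-1 = (\adj (SLmx g))%R.
Proof. by rewrite /SLmx set_valE/= /invmx SLmx_unit det_SLmx invr1 scale1r. Qed.

(** A cluster point in the compact matrix box still has determinant 1, a closed condition, so it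
    lies in [SL] and is a cluster point for the induced topology. *)
Lemma compact_SL_box (r : R) :
  compact [set g : SL R n | forall i j, `|SLmx g i j| <= r]%R.
Proof.
move=> F FF Fr.
have [M [Mr clM]] := @compact_mx_box R n n r (SLmx g @[g --> F])
  (fmap_proper_filter _ FF) Fr.
have M1 : (\det M = 1)%R.
  have cdet : closed [set N : 'M[R]_n | \det N = 1]%R.
    rewrite (_ : [set _ | _] = (@determinant R n) @^-1` [set 1%R])//.
    apply: preimage_closed; last exact: closed_eq.
    by move=> N _; apply: (cvg_det (nbhs_filter N)); exact: cvg_id.
  apply: cdet => U MU; apply: clM MU.
  by apply: (@filterE _ F) => g; exact: det_SLmx.
exists (mkSL M1); split=> // A B FA [_ [[C oC <-] CM sCB]].
have FA' : (SLmx g @[g --> F]) (@SLmx R n @` A).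
  by apply: (@filterS _ F _ _ _ _ FA) => g Ag; exists g.
have [_ [[g Ag <-] Cg]] := clM _ _ FA' (open_nbhs_nbhs (conj oC CM)).
by exists g; split => //; exact: sCB.
Qed.

(** The saturation of [U] is a union of right translates of [U] by elements of SL(n,Z), each of them
    open. *)
Lemma open_cosetZ (U : set (SL R n)) : open U -> open (@cosetZ R n @` U).
Proof.
move=> oU; rewrite /open/= /quotient_open.
rewrite (_ : _ @^-1` _ = \bigcup_(c in @SLZ R n) ((fun h => h * c) @^-1` U)).
  apply: bigcup_open => c _.
  by move/continuousP: (@SL_mulr_continuous c); exact.
apply/seteqP; split => g /=.
  move=> [h Uh /esym /eq_cosetZ gh]; exists (g^-1 * h) => //=.
  by rewrite mulgA mulgV mul1g.
move=> [c cZ /= Ugc]; exists (g * c) => //.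
by apply/esym/eq_cosetZ; rewrite /eqmodZ mulgA mulVg mul1g.
Qed.

(** For distinct cosets of [g] and [h], some entry of [g^-1 * h] is not an integer. This persists
    for nearby pairs, so small neighbourhoods of [g] and [h] have disjoint images, which are
    open. *)
Lemma SLquo_hausdorff : hausdorff_space (SLquo R n).
Proof.
rewrite open_hausdorff => x y.
have [g ->] := cosetZP x; have [h ->] := cosetZP y => /eqP gh.
have [i [j ghij]] : exists i j, SLmx (g^-1 * h) i j \isn't a Num.int.
  apply: contrapT => /forallNP ghZ; apply: gh; apply/eq_cosetZ/mxOverP => i j.
  by apply: contrapT => /negP ghij; apply: (ghZ i); exists j.
have : nbhs (g, h) [set p : SL R n * SL R n |
    SLmx (p.1^-1 * p.2) i j \isn't a Num.int].
  have c : SLmx (p.1^-1 * p.2) i j @[p --> (g, h)] --> SLmx (g^-1 * h) i j.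
    have c1 : SLmx p.1 @[p --> (g, h)] --> SLmx g.
      exact: (@continuous_comp _ _ _ fst (@SLmx R n) (g, h)
        (@cvg_fst _ _ _ _ _) (@SLmx_continuous g)).
    have c2 : SLmx p.2 @[p --> (g, h)] --> SLmx h.
      exact: (@continuous_comp _ _ _ snd (@SLmx R n) (g, h)
        (@cvg_snd _ _ _ _ _) (@SLmx_continuous h)).
    apply: cvg_mx_coord; apply: cvg_mulmx; last exact: c2.
    rewrite SLmx_inv; under eq_fun do rewrite SLmx_inv.
    exact: cvg_adj.
  apply: (c [set r : R | r \isn't a Num.int]).
  by apply: open_nbhs_nbhs; split => //; exact: open_not_int.
move=> [[U V] /= [gU hV] UV].
exists (@cosetZ R n @` U°, @cosetZ R n @` V°).
  by split; apply/mem_set; [exists g|exists h] => //; exact: nbhs_interior.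
split; [exact/open_cosetZ/open_interior|exact/open_cosetZ/open_interior|].
apply/eqP/seteqP; split=> // _ [[a /interior_subset Ua <-]].
move=> [b /interior_subset Vb] /esym/eq_cosetZ/mxOverP/(_ i j) abZ.
by have /negP := UV (a, b) (conj Ua Vb).
Qed.

(** These compact sets serve both as compact neighbourhoods and, for integer [r], as an exhaustion
    of the quotient. *)
Definition SLquo_box (r : R) : set (SLquo R n) :=
  @cosetZ R n @` [set g | forall i j, `|SLmx g i j| <= r]%R.

Lemma compact_SLquo_box (r : R) : compact (SLquo_box r).
Proof.
apply: continuous_compact; last exact: compact_SL_box.
by apply: continuous_subspaceT; exact: pi_continuous.
Qed.

(** The strict inequality leaves room for the box of radius [r] to be a neighbourhood of [g]. *)
Lemma SLmx_bounded (g : SL R n) :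
  exists r : R, forall i j, (`|SLmx g i j| < r)%R.
Proof.
exists (`|SLmx g| + 1)%R => i j.
rewrite (@le_lt_trans _ _ `|SLmx g|%R) ?ltrDl//.
rewrite [leRHS]mx_normrE.
exact: (le_bigmax _ (fun ij : 'I_n * 'I_n => `|SLmx g ij.1 ij.2|%R) (i, j)).
Qed.

Lemma SLquo_locally_compact : locally_compact [set: SLquo R n].
Proof.
move=> x _; rewrite withinET.
have [g ->] := cosetZP x; have [r gr] := SLmx_bounded g.
exists (SLquo_box r); last first.
  split; first exact: compact_SLquo_box.
  by apply: compact_closed; [exact: SLquo_hausdorff|exact: compact_SLquo_box].
have : nbhs g [set h : SL R n | forall i j, `|SLmx h i j| <= r]%R.
  apply: (@filter_forall _ _ (fun i h => forall j, `|SLmx h i j| <= r)%R _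
    (nbhs_filter g)) => i.
  apply: (@filter_forall _ _ (fun j h => `|SLmx h i j| <= r)%R _
    (nbhs_filter g)) => j.
  have c : `|SLmx h i j|%R @[h --> g] --> `|SLmx g i j|%R.
    apply: (cvg_norm (FF := nbhs_filter g)).
    by apply: cvg_mx_coord; exact: SLmx_continuous.
  apply: (c [set s | s <= r]%R).
  by apply: filterS (lt_nbhsl (gr i j)) => s; exact: ltW.
rewrite nbhsE => -[U [oU Ug] Ur].
exists (@cosetZ R n @` U); last exact: image_subset.
by split; [exact: open_cosetZ|exists g].
Qed.

Lemma SLquo_Cc_int_gt0 (nu : nzmeasure R (SLquo R n)) :
  exists2 f, Cc R (SLquo R n) f & (0 < lfm_int f nu)%R.
Proof.
apply: (@Cc_int_gt0 _ _ SLquo_hausdorff SLquo_locally_compact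
  (fun j => SLquo_box j%:R)); first by move=> j; exact: compact_SLquo_box.
apply/seteqP; split=> // x _; have [g ->] := cosetZP x.
have [r gr] := SLmx_bounded g.
(* The archimedean property supplies a natural number above [|r|]. *)
exists (Num.bound `|r|%R) => //; exists g => // i j.
rewrite (le_trans (ltW (gr i j)))// (le_trans (ler_norm _))// ltW//.
exact/Num.Theory.archi_boundP/normr_ge0.
Qed.

(** Stated for any sequence of nonzero measures, so that it specializes to the translates of orbit
    measures of both [A] and [H]. *)
Lemma cvg_mclass_SLquo (m : nat -> nzmeasure R (SLquo R n))
    (nu : nzmeasure R (SLquo R n)) :
  mclass (m k) @[k --> \oo] --> mclass nu ->
  (exists lambda : nat -> {posnum R},
    lfm_scale (lambda k) (m k) @[k --> \oo] -->
    (nzm_val nu : measure_space R (SLquo R n))) /\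
  (forall F1 F2 : SLquo R n -> R,
    Cc R (SLquo R n) F1 -> Cc R (SLquo R n) F2 ->
    lfm_int F1 nu <> 0%R ->
    (lfm_int F2 (m k) / lfm_int F1 (m k))%R
      @[k --> \oo] --> (lfm_int F2 nu / lfm_int F1 nu)%R).
Proof.
move=> mnu; have [f0 Cf0 nu0] := SLquo_Cc_int_gt0 nu.
have [lambda lnu] := cvg_mclass_scale Cf0 nu0 mnu.
by split; [exists lambda|move=> F1 F2; exact: cvg_lfm_int_ratio lnu].
Qed.

End SLquoTopology.

Theorem theorem2p8 (R : realType) (n : nat) (x : SLquo R n)
    (Ax : divergent_orbit x) :
  (forall (mu nu : nzmeasure R (SLquo R n)) (g : nat -> SL R n),
    orbit_measure (diagA R n) x mu ->
    periodic_measure nu ->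
    mclass (nzm_push (g k) mu) @[k --> \oo] --> mclass nu ->
    (exists lambda : nat -> {posnum R},
      lfm_scale (lambda k) (nzm_push (g k) mu) @[k --> \oo] -->
      (nzm_val nu : measure_space R (SLquo R n))) /\
    (forall F1 F2 : SLquo R n -> R,
      Cc R (SLquo R n) F1 -> Cc R (SLquo R n) F2 ->
      lfm_int F1 nu <> 0 ->
      lfm_int F2 (nzm_push (g k) mu) / lfm_int F1 (nzm_push (g k) mu)
        @[k --> \oo] --> lfm_int F2 nu / lfm_int F1 nu)) /\
  (forall (H : set (SL R n)) (mu nu : nzmeasure R (SLquo R n))
      (g : nat -> SL R n),
    connected_reductive H ->
    diagA R n `<=` H ->
    orbit_measure H x mu ->
    periodic_measure nu ->
    mclass (nzm_push (g k) mu) @[k --> \oo] --> mclass nu ->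
    (exists lambda : nat -> {posnum R},
      lfm_scale (lambda k) (nzm_push (g k) mu) @[k --> \oo] -->
      (nzm_val nu : measure_space R (SLquo R n))) /\
    (forall F1 F2 : SLquo R n -> R,
      Cc R (SLquo R n) F1 -> Cc R (SLquo R n) F2 ->
      lfm_int F1 nu <> 0 ->
      lfm_int F2 (nzm_push (g k) mu) / lfm_int F1 (nzm_push (g k) mu)
        @[k --> \oo] --> lfm_int F2 nu / lfm_int F1 nu)).
Proof.
split=> [mu nu g _ _|H mu nu g _ _ _ _]; exact: cvg_mclass_SLquo.
Qed.
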